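(* Let $(H,\circ)$ be a $\le$-hypergroupoid. If $F$ is a filter of $H$, then the characteristic function $f_F$ is a fuzzy filter of $H$. Conversely, if $F$ is a nonempty subset of $H$ such that $f_F$ is a fuzzy filter of $H$, then $F$ is a filter of $H$.
   Context: Let ${\cal P}^*(H)$ denote the set of nonempty subsets of $H$. A hypergroupoid $(H,\circ)$ is a nonempty set $H$ with a hyperoperation $\circ : H\times H\to {\cal P}^*(H)$, $(a,b)\mapsto a\circ b$. No associativity is assumed. A $\le$-hypergroupoid is a hypergroupoid $H$ endowed with an arbitrary binary relation denoted $\le$ (not necessarily an order, and not assumed compatible with $\circ$); $b\ge a$ means $a\le b$. A nonempty subset $F$ of a $\le$-hypergroupoid $H$ is a filter of $H$ if (1) if $x,y\in F$, then $x\circ y\subseteq F$; (2) if $x,y\in H$ and $x\circ y\subseteq F$, then $x\in F$ and $y\in F$; (3) if $x,y\in H$, then $x\circ y\subseteq F$ or $(x\circ y)\cap F=\emptyset$; (4) if $x\in F$, $y\in H$ and $y\ge x$, then $y\in F$. A fuzzy subset of $H$ is any mapping $f:H\to[0,1]$. A fuzzy subset $f$ of $H$ is a fuzzy filter of $H$ if (1) $x\le y$ implies $f(x)\le f(y)$ for all $x,y\in H$, and (2) for all $x,y\in H$ and all $u\in x\circ y$, $f(u)=\min\{f(x),f(y)\}$. For $A\subseteq H$, the characteristic function $f_A:H\to\{0,1\}\subseteq[0,1]$ is given by $f_A(x)=1$ if $x\in A$ and $f_A(x)=0$ if $x\notin A$. *)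

(* Defs.v *)
(* The unit interval [0,1] is taken in an arbitrary R : realType. *)
From mathcomp Require Export all_boot all_order all_algebra.
From mathcomp Require Export boolp classical_sets reals numfun.
Export Order.TTheory GRing.Theory Num.Theory.

Set Implicit Arguments.
Unset Strict Implicit.
Unset Printing Implicit Defensive.

Local Open Scope classical_set_scope.
Local Open Scope ring_scope.

Record hypergroupoid := Hypergroupoid {
  carrier :> Type;
  carrier_nonempty : [set: carrier] !=set0;
  hop : carrier -> carrier -> set carrier;
  hop_nonempty : forall a b, hop a b !=set0
}.

(* hle is an arbitrary relation: neither an order nor compatible with hop. *)
Record le_hypergroupoid := LeHypergroupoid {
  hypergroupoid_of :> hypergroupoid;
  hle : hypergroupoid_of -> hypergroupoid_of -> Prop
}.

Definition hfilter (H : le_hypergroupoid) (F : set H) : Prop :=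
  [/\ F !=set0,
      forall x y : H, F x -> F y -> hop x y `<=` F,
      forall x y : H, hop x y `<=` F -> F x /\ F y,
      forall x y : H, hop x y `<=` F \/ hop x y `&` F = set0 &
      forall x y : H, F x -> hle x y -> F y].

Definition fuzzy_subset (R : realType) (T : Type) (f : T -> R) : Prop :=
  forall x, 0 <= f x <= 1.

Definition fuzzy_filter (R : realType) (H : le_hypergroupoid) (f : H -> R) :
    Prop :=
  [/\ fuzzy_subset f,
      forall x y : H, hle x y -> f x <= f y &
      forall x y u : H, hop x y u -> f u = Num.min (f x) (f y)].

(* Main.v *)
Require Import Defs.

(** The indicator of [F] takes only the values [0] and [1], so inequalities and
    minima of its values encode logic: [\1_F x <= \1_F y] is the implication
    from [F x] to [F y] ([indic_leP]), and [\1_F u = min (\1_F x) (\1_F y)] is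
    the equivalence of [F u] with [F x /\ F y] ([indic_minP]).  The monotonicity
    of the indicator is therefore the upward closure of [F], and what remains is
    purely set-theoretic ([hop_mem_iffP]): the first three closure conditions of
    a filter say together that, for [u] in [hop x y], membership of [u] in [F]
    amounts to that of both [x] and [y]. *)

Local Open Scope classical_set_scope.
Local Open Scope ring_scope.

Lemma indic_ge0_le1 (R : realType) (T : Type) (F : set T) (x : T) :
  0 <= (\1_F x : R) <= 1.
Proof. by rewrite indicE; case: (x \in F); rewrite ?lexx ler01. Qed.

Lemma indic_leP (R : realType) (T : Type) (F : set T) (x y : T) :
  (\1_F x <= \1_F y :> R) <-> (F x -> F y).
Proof.
rewrite !indicE ler_nat -(in_setE F x) -(in_setE F y).
by case: (x \in F); case: (y \in F); split=> // /(_ isT).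
Qed.

(** On the values [0] and [1], the minimum is conjunction. *)
Lemma indic_minP (R : realType) (T : Type) (F : set T) (x y u : T) :
  (\1_F u = Num.min (\1_F x) (\1_F y) :> R) <-> (F u <-> F x /\ F y).
Proof.
rewrite !indicE -natr_min -(in_setE F u) -(in_setE F x) -(in_setE F y).
split=> [/eqP|].
  rewrite eqr_nat.
  by case: (u \in F); case: (x \in F); case: (y \in F) => // _; split=> // -[].
case: (u \in F); case: (x \in F); case: (y \in F) => // -[h1 h2];
  by [have [] := h1 isT | have := h2 (conj isT isT)].
Qed.

(** The dichotomy is what lets a single [u] of [hop x y] lying in [F] give
    [hop x y `<=` F], and hence [x] and [y] in [F].  Conversely, the nonemptiness
    of [hop x y] supplies the [u] from which [F x] and [F y] are recovered. *)
Lemma hop_mem_iffP (H : hypergroupoid) (F : set H) :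
  (forall x y u : H, hop x y u -> (F u <-> F x /\ F y)) <->
  [/\ forall x y : H, F x -> F y -> hop x y `<=` F,
      forall x y : H, hop x y `<=` F -> F x /\ F y &
      forall x y : H, hop x y `<=` F \/ hop x y `&` F = set0].
Proof.
split=> [hF|[hop_sub sub_mem dich] x y u xyu].
  split=> [x y Fx Fy u /hF ->//|x y sF|x y].
    by have [u xyu] := hop_nonempty x y; apply/(hF _ _ _ xyu)/sF.
  have [Fxy|nFxy] := pselect (F x /\ F y); first by left=> u /hF ->.
  by right; rewrite -subset0 => u [/hF Fu /Fu].
split=> [Fu|[Fx Fy]]; last exact: hop_sub xyu.
have [/sub_mem//|xyF0] := dich x y.
by have : (hop x y `&` F) u by []; rewrite xyF0.
Qed.

Theorem proposition12 (R : realType) (H : le_hypergroupoid) :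
  (forall F : set H, hfilter F -> fuzzy_filter (\1_F : H -> R)) /\
  (forall F : set H, F !=set0 -> fuzzy_filter (\1_F : H -> R) -> hfilter F).
Proof.
split=> F.
  move=> [_ hop_sub sub_mem dich upF].
  have /hop_mem_iffP hF := And3 hop_sub sub_mem dich.
  split=> [x|x y xy|x y u xyu]; first exact: indic_ge0_le1.
    by apply/indic_leP => Fx; apply: upF xy.
  by apply/indic_minP/hF.
move=> F0 [_ monoF minF].
have /hop_mem_iffP[hop_sub sub_mem dich] :
    forall x y u : H, hop x y u -> (F u <-> F x /\ F y).
  by move=> x y u /minF /indic_minP.
by split=> // x y Fx /monoF /indic_leP; apply.
Qed.
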